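(* Let $G$ be a finite, simple, connected, bipartite graph with $|V(G)|>1$ and bipartition $V(G)=A_G\cup B_G$. Let $X\in\{A_G,B_G\}$ and let $D$ be a minimum dominating set of $G$. Let $H$ be any finite, simple graph. Write $D^\ast(X)=D\cap X$ and $\delta^\ast(X)=|D^\ast(X)|/|X|$. If $\delta^\ast(X)>\delta(H)$, then $$\gamma(G\square H)+\tau_X\,|V(H)|\ \ge\ \gamma(G)\gamma(H),$$ where $\tau_X:=\min\{|S| : S\subseteq D^\ast(X)\text{ such that } |S|/|X|>\delta(H)\}$.
   Context: $\gamma(G)$ is the domination number of $G$, i.e. the minimum cardinality of a dominating set of $G$ (a set $D\subseteq V(G)$ such that every vertex is in $D$ or adjacent to a vertex of $D$). A minimum dominating set is a dominating set of cardinality $\gamma(G)$. $G\square H$ is the Cartesian product of the graphs $G$ and $H$. The domination density is $\delta(G):=\gamma(G)/|V(G)|$ (so $\delta$ does not denote minimum degree). *)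

(* Defs.v *)
From HB Require Import structures.
From mathcomp Require Import all_boot all_order all_algebra.
Set Implicit Arguments.
Unset Strict Implicit.
Unset Printing Implicit Defensive.

Import Order.TTheory GRing.Theory Num.Theory.

Record sgraph := SGraph {
  vertex :> finType;
  adj : rel vertex;
  adj_sym : symmetric adj;
  adj_irrefl : irreflexive adj
}.

Definition connected (G : sgraph) : Prop := forall x y : G, connect (@adj G) x y.

Definition bipartition (G : sgraph) (A B : {set G}) : Prop :=
  [/\ A :|: B = [set: G], A :&: B = set0 &
      forall x y : G, adj x y ->
        (x \in A) && (y \in B) || (x \in B) && (y \in A)].

Definition dominating (G : sgraph) (D : {set G}) : bool :=
  [forall x : G, (x \in D) || [exists y in D, adj x y]].

Definition gamma (G : sgraph) : nat :=
  #|[arg min_(D < [set: G] | dominating D) #|D|]|.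

Definition min_dominating (G : sgraph) (D : {set G}) : Prop :=
  dominating D /\ #|D| = gamma G.

(* Since x / 0 = 0 in [rat], the graph without vertices has density 0. *)
Definition density (G : sgraph) : rat := ((gamma G)%:R / #|G|%:R)%R.

Definition set_density (G : sgraph) (S X : {set G}) : rat :=
  (#|S|%:R / #|X|%:R)%R.

Definition cart_adj (G H : sgraph) : rel (G * H)%type :=
  fun u v => (u.1 == v.1) && adj u.2 v.2 || (u.2 == v.2) && adj u.1 v.1.

Lemma cart_adj_sym (G H : sgraph) : symmetric (@cart_adj G H).
Proof.
move=> u v; rewrite /cart_adj (eq_sym v.1) (eq_sym v.2).
by rewrite (adj_sym u.1) (adj_sym u.2).
Qed.

Lemma cart_adj_irrefl (G H : sgraph) : irreflexive (@cart_adj G H).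
Proof. by move=> u; rewrite /cart_adj !adj_irrefl !andbF. Qed.

Definition cart_prod (G H : sgraph) : sgraph :=
  SGraph (@cart_adj_sym G H) (@cart_adj_irrefl G H).

(* The seed [Dstar] of [arg min] satisfies the constraint as soon as
   [d < set_density Dstar X]; only then is this the intended minimum. *)
Definition tau (G : sgraph) (X Dstar : {set G}) (d : rat) : nat :=
  #|[arg min_(S < Dstar | (S \subset Dstar) && (d < set_density S X)%R) #|S|]|.

(* Main.v *)
Require Import Defs.
From HB Require Import structures.
From mathcomp Require Import all_boot all_order all_algebra.
Set Implicit Arguments.
Unset Strict Implicit.
Unset Printing Implicit Defensive.

Import Order.TTheory GRing.Theory Num.Theory.

(** The term [tau * #|H|] alone is already at least [gamma G * gamma H].  A side
    [X] of the bipartition of a connected graph with at least two vertices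
    dominates it: a vertex outside [X] has a neighbour, and all its neighbours
    lie in [X] ([side_dominating]).  Hence [gamma G <= #|X|].  On the other hand,
    clearing denominators in [gamma H / #|H| < #|S| / #|X|], where [S] attains
    [tau], gives [gamma H * #|X| <= #|S| * #|H|] ([density_lt_cross]), so
    [gamma G * gamma H <= #|X| * gamma H <= tau * #|H|]. *)

Lemma gamma_le (G : sgraph) (D : {set G}) : dominating D -> gamma G <= #|D|.
Proof.
rewrite /gamma => domD; case: arg_minnP => [|E _ minE]; last exact: minE.
by apply/forallP => x; rewrite inE.
Qed.

Lemma connected_has_neighbour (G : sgraph) (x : G) :
  connected G -> 1 < #|G| -> exists y, adj x y.
Proof.
move=> connG cardG.
have [z zx] : exists z, z != x.
  have /card_gt0P [z] : 0 < #|predC1 x| by rewrite cardC1 -ltnS prednK // ltnW.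
  by exists z.
(* The first step of a path from [x] to [z]; it exists because [z != x]. *)
have /connectP [[|y p] /= xp def_z] := connG x z.
  by rewrite def_z eqxx in zx.
by exists y; case/andP: xp.
Qed.

Lemma side_dominating (G : sgraph) (A B X : {set G}) :
  connected G -> 1 < #|G| -> bipartition A B -> X \in [set A; B] ->
  dominating X.
Proof.
move=> connG cardG [_ _ bip] inX; apply/forallP => x.
have [//|/= xX] := boolP (x \in X).
have [y xy] := connected_has_neighbour x connG cardG.
apply/existsP; exists y; rewrite xy andbT.
have /orP[] := bip _ _ xy => /andP[xS yS];
  by move: inX xX; rewrite !inE => /orP[] /eqP ->; rewrite ?xS ?yS.
Qed.

Lemma density_ge0 (G : sgraph) : (0 <= density G)%R.
Proof. by rewrite /density divr_ge0 ?ler0n. Qed.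

(** Multiplying out is legitimate because the hypothesis forces [X] to be
    nonempty.  The conclusion is not strict only because of the empty [H], for
    which both sides vanish. *)
Lemma density_lt_cross (G H : sgraph) (S X : {set G}) :
  (density H < set_density S X)%R -> gamma H * #|X| <= #|S| * #|H|.
Proof.
move=> lt_dens.
have X_gt0 : 0 < #|X|.
  rewrite lt0n; apply/eqP => X0; move: lt_dens.
  by rewrite /set_density X0 invr0 mulr0 ltNge density_ge0.
have [H0|H_gt0] := posnP #|H|.
  have : gamma H <= #|H| by apply: max_card.
  by rewrite H0 leqn0 => /eqP ->.
move: lt_dens; rewrite /density /set_density.
rewrite ltr_pdivrMr ?ltr0n // mulrAC ltr_pdivlMr ?ltr0n //.
by rewrite -!natrM ltr_nat => /ltnW.
Qed.

Lemma tau_attained (G : sgraph) (X Dstar : {set G}) (d : rat) :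
  (d < set_density Dstar X)%R ->
  exists2 S : {set G}, (d < set_density S X)%R & #|S| = tau X Dstar d.
Proof.
rewrite /tau => dens.
case: arg_minnP => [|S /andP[_ densS] _]; first by rewrite subxx.
by exists S.
Qed.

Theorem theorem1 (G : sgraph) (A B X D : {set G}) (H : sgraph)
  (connG : connected G) (cardG : 1 < #|G|) (bipG : bipartition A B)
  (inX : X \in [set A; B]) (minD : min_dominating D)
  (dens : (density H < set_density (D :&: X) X)%R) :
  gamma (cart_prod G H) + tau X (D :&: X) (density H) * #|H|
    >= gamma G * gamma H.
Proof.
have [S densS <-] := tau_attained dens.
have leGX := gamma_le (side_dominating connG cardG bipG inX).
apply: leq_trans (leq_addl _ _).
apply: leq_trans (density_lt_cross densS).
by rewrite mulnC leq_mul2l leGX orbT.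
Qed.
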